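(* Let $V<C<M$ be real numbers and let $0\le p_1\le p_2\le p_3\le p_4\le 1$, $\tilde p=(p_1,p_2,p_3,p_4)$. For $\beta\in[0,1]$ let $$F_{\tilde p,\beta}(x)=\frac12H(x)+(1-\beta)\big(J(x)-H(x)\big),\qquad Q^*_{\tilde p,\beta}=F_{\tilde p,\beta}^{-1}\left(\frac{M-C}{M-V}\right),$$ with $H,J$ as defined in the context. Then the optimal order quantity $Q^*_{\tilde p,\beta}$ is a non-decreasing function of the risk factor $\beta\in[0,1]$.
   Context: For $i=1,2$, $F_i$ is the cumulative distribution function of the normal distribution with mean $\mu_i\in\mathbb{R}$ and standard deviation $\sigma_i>0$. Constants: $P_1=\frac{p_1p_3}{3}+\frac{2p_2p_3}{3}+\frac{2p_1p_4}{3}+\frac{p_2p_4}{3}$, $P_2=\frac{p_1+p_2+p_3+p_4}{2}-\frac{p_1p_3}{3}-\frac{2p_1p_4}{3}-\frac{2p_2p_3}{3}-\frac{p_2p_4}{3}$, $P_3=2-(p_1+p_2+p_3+p_4)+\frac{p_1p_3}{3}+\frac{2p_1p_4}{3}+\frac{2p_2p_3}{3}+\frac{p_2p_4}{3}$. Functions: $H(x)=P_1F_1(x)^2+2P_2F_1(x)F_2(x)+P_3F_2(x)^2$, $J(x)=P_1F_1(x)+P_2(F_1(x)+F_2(x))+P_3F_2(x)$. $F_{\tilde p,\beta}^{-1}(y)$ denotes the unique real $x$ with $F_{\tilde p,\beta}(x)=y$, for $y\in(0,1)$. *)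

(* Defs.v *)
From HB Require Import structures.
From mathcomp Require Import all_boot all_order all_algebra.
From mathcomp Require Import all_classical all_reals all_analysis.

Set Implicit Arguments.
Unset Strict Implicit.
Unset Printing Implicit Defensive.

Import Order.TTheory GRing.Theory Num.Theory.
Import numFieldNormedType.Exports.

Local Open Scope classical_set_scope.
Local Open Scope ring_scope.

Section NormalCdf.
Variables (R : realType) (mu sigma : R).

Let idTR : measurableTypeR R -> R := idfun.

#[local] HB.instance Definition _ :=
  @isMeasurableFun.Build _ _ _ _ idTR (@measurable_id _ _ setT).

(* [cdf] takes a random variable, here the identity on the probability space
   (R, normal_prob mu sigma). For sigma = 0, [normal_prob] is a uniform law,
   not a Dirac mass: the hypothesis 0 < sigma matters. *)
Definition normal_cdf (x : R) : R :=
  fine (cdf (idTR : {RV (normal_prob mu sigma) >-> R}) x).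

End NormalCdf.

Section Mixture.
Variables (R : realType) (p1 p2 p3 p4 : R).

Definition P1 : R :=
  p1 * p3 / 3 + 2 * p2 * p3 / 3 + 2 * p1 * p4 / 3 + p2 * p4 / 3.

Definition P2 : R :=
  (p1 + p2 + p3 + p4) / 2 - p1 * p3 / 3 - 2 * p1 * p4 / 3
  - 2 * p2 * p3 / 3 - p2 * p4 / 3.

Definition P3 : R :=
  2 - (p1 + p2 + p3 + p4) + p1 * p3 / 3 + 2 * p1 * p4 / 3
  + 2 * p2 * p3 / 3 + p2 * p4 / 3.

Variables F1 F2 : R -> R.

Definition H (x : R) : R :=
  P1 * F1 x ^+ 2 + 2 * P2 * F1 x * F2 x + P3 * F2 x ^+ 2.

Definition J (x : R) : R := P1 * F1 x + P2 * (F1 x + F2 x) + P3 * F2 x.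

Definition F_beta (beta x : R) : R := 2^-1 * H x + (1 - beta) * (J x - H x).

End Mixture.

(* Definite description: 0 is only a default for when no unique preimage exists. *)
Definition the_preimage (R : realType) (f : R -> R) (y : R) : R :=
  xget 0 [set x | unique (fun z => f z = y) x].

Definition optimal_quantity (R : realType) (V C M p1 p2 p3 p4 : R)
    (F1 F2 : R -> R) (beta : R) : R :=
  the_preimage (F_beta p1 p2 p3 p4 F1 F2 beta) ((M - C) / (M - V)).

(* Main.v *)
(* With a = F1 x and b = F2 x in [0, 1],
     J - H = P1 a (1 - a) + P2 (a (1 - b) + b (1 - a)) + P3 b (1 - b) >= 0,
   because P1, P2, P3 are nonnegative as soon as all pi lie in [0, 1]; hence
   F_beta decreases pointwise in beta. Since P1 + 2 P2 + P3 = 2, some Pi is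
   positive, which makes F_beta a strictly increasing continuous function from
   0 to 1, like the two normal distribution functions. So its quantiles exist,
   are unique, and move to the right when F_beta decreases. *)
Require Import Defs.
From mathcomp Require Import all_boot all_order all_algebra.
From mathcomp Require Import all_classical all_reals all_analysis.
From mathcomp Require Import measurable_realfun.
From mathcomp Require Import ring lra.

Import Order.TTheory GRing.Theory Num.Theory.
Import numFieldNormedType.Exports.

Local Open Scope classical_set_scope.
Local Open Scope ring_scope.

(** * Normal distribution functions: strict growth, continuity, limits *)

Section NormalCdfTheory.
Variables (R : realType) (m s : R).
Hypothesis s_neq0 : s != 0.

Lemma normal_cdfE (x : R) :
  (normal_cdf m s x)%:E = normal_prob m s `]-oo, x].
Proof.
rewrite /normal_cdf fineK//; apply: fin_num_measure.
exact: measurable_itv.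
Qed.

(** Turns increments into integrals of the density, to be bounded from below and from above. *)
Lemma normal_cdf_itv (x y : R) : x <= y ->
  (normal_cdf m s y - normal_cdf m s x)%:E = normal_prob m s `]x, y].
Proof.
move=> xy; rewrite EFinB !normal_cdfE.
have -> : `]-oo, y]%classic = `]-oo, x] `|` `]x, y].
  by rewrite -(@itv_bndbnd_setU _ _ _ (BRight x)).
rewrite measureU//=; last first.
  by apply/seteqP; split => // z /=; rewrite !in_itv/=; lra.
by rewrite addeAC subee ?add0e// -normal_cdfE.
Qed.

(** The continuous density has a positive minimum on [[x, y]]; the mass of []x, y]] is at least this
    minimum times [y - x]. *)
Lemma normal_cdf_mono (x y : R) : x < y -> normal_cdf m s x < normal_cdf m s y.
Proof.
move=> xy; rewrite -subr_gt0 -lte_fin normal_cdf_itv ?ltW//.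
have [|c _ cmin] := @EVT_min R (normal_pdf m s) x y (ltW xy).
  by apply: continuous_subspaceT; exact: continuous_normal_pdf.
have c_gt0 : 0 < normal_pdf m s c.
  by rewrite normal_pdfE// mulr_gt0 ?normal_peak_gt0 ?expR_gt0.
apply: (@lt_le_trans _ _
    (\int[lebesgue_measure]_(z in `]x, y]) (normal_pdf m s c)%:E)%E).
  rewrite integral_cst//= lebesgue_measure_itv/= lte_fin xy -EFinB -EFinM.
  by rewrite lte_fin mulr_gt0// subr_gt0.
apply: ge0_le_integral => //=.
- by move=> z _; rewrite lee_fin ltW.
- by apply/measurable_EFinP/measurable_funTS; exact: measurable_normal_pdf.
- move=> z; rewrite in_itv/= => /andP[xz zy].
  by rewrite lee_fin; apply: cmin; rewrite in_itv/= (ltW xz).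
Qed.

(** The density never exceeds its peak; continuity follows from this bound. *)
Lemma normal_cdf_lipschitz (x y : R) : x <= y ->
  normal_cdf m s y - normal_cdf m s x <= normal_peak s * (y - x).
Proof.
move=> xy; rewrite -lee_fin normal_cdf_itv//.
apply: (@le_trans _ _
    (\int[lebesgue_measure]_(z in `]x, y]) (normal_peak s)%:E)%E).
  apply: ge0_le_integral => //=.
  - by move=> z _; rewrite lee_fin normal_pdf_ge0.
  - by apply/measurable_EFinP/measurable_funTS; exact: measurable_normal_pdf.
  - by move=> z _; rewrite lee_fin normal_pdf_ub.
rewrite integral_cst//= lebesgue_measure_itv/= lte_fin.
case: ifPn => [_|]; first by rewrite -EFinB -EFinM.
by rewrite mule0 lee_fin mulr_ge0 ?normal_peak_ge0 ?subr_ge0.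
Qed.

Lemma continuous_normal_cdf : continuous (normal_cdf m s).
Proof.
have lip x y :
    `|normal_cdf m s x - normal_cdf m s y| <= normal_peak s * `|x - y|.
  wlog yx : x y / y <= x => [hw|].
    have [yx|/ltW xy] := leP y x; first exact: hw.
    by rewrite distrC (distrC x); exact: hw.
  rewrite (ger0_norm (x := x - y)) ?subr_ge0// ger0_norm.
    exact: normal_cdf_lipschitz.
  by rewrite -lee_fin normal_cdf_itv.
move=> x; apply/cvgrPdist_lt => e e0; near=> y.
apply: le_lt_trans (lip x y) _.
rewrite mulrC -ltr_pdivlMr ?normal_peak_gt0//; near: y.
by apply: cvgr_dist_lt; rewrite ?divr_gt0 ?normal_peak_gt0//; exact: cvg_id.
Unshelve. all: by end_near. Qed.

Lemma normal_cdf_ge0 (x : R) : 0 <= normal_cdf m s x.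
Proof. by rewrite -lee_fin normal_cdfE. Qed.

Lemma normal_cdf_le1 (x : R) : normal_cdf m s x <= 1.
Proof. by rewrite -lee_fin normal_cdfE probability_le1. Qed.

Lemma cvg_normal_cdfy : normal_cdf m s x @[x --> +oo] --> (1 : R).
Proof. by apply: fine_cvg; exact: cvg_cdfy1. Qed.

Lemma cvg_normal_cdfNy : normal_cdf m s x @[x --> -oo] --> (0 : R).
Proof. by apply: fine_cvg; exact: cvg_cdfNy0. Qed.

End NormalCdfTheory.

(** * The mixture and its dependence on [x] and [beta] *)

Section Mixture.
Variables (R : realType) (p1 p2 p3 p4 : R).

Local Notation in01 p := (0 <= p <= 1).

Lemma P1_ge0 : 0 <= p1 -> 0 <= p2 -> 0 <= p3 -> 0 <= p4 ->
  0 <= P1 p1 p2 p3 p4.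
Proof. by move=> ? ? ? ?; rewrite /P1 !addr_ge0 ?divr_ge0 ?mulr_ge0. Qed.

(* Each product pi * pj of P1 is at most its arithmetic mean (pi + pj) / 2;
   weighted by (1, 2, 2, 1) / 3, these means add up to (p1+p2+p3+p4) / 2. *)
Lemma P2_ge0 : in01 p1 -> in01 p2 -> in01 p3 -> in01 p4 ->
  0 <= P2 p1 p2 p3 p4.
Proof.
have mean (p q : R) : in01 p -> in01 q -> p * q <= (p + q) / 2 by nra.
move=> h1 h2 h3 h4; rewrite /P2.
have := mean _ _ h1 h3; have := mean _ _ h1 h4.
by have := mean _ _ h2 h3; have := mean _ _ h2 h4; lra.
Qed.

Lemma P3_ge0 : p1 <= 1 -> p2 <= 1 -> p3 <= 1 -> p4 <= 1 ->
  0 <= P3 p1 p2 p3 p4.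
Proof.
move=> ? ? ? ?.
(* Replacing every [p] by [1 - p] turns [P1] into [P3]. *)
have -> : P3 p1 p2 p3 p4 = P1 (1 - p1) (1 - p2) (1 - p3) (1 - p4).
  by rewrite /P1 /P3; field.
by rewrite /P1 !addr_ge0 ?divr_ge0 ?mulr_ge0 ?subr_ge0.
Qed.

Lemma P_sum : P1 p1 p2 p3 p4 + 2 * P2 p1 p2 p3 p4 + P3 p1 p2 p3 p4 = 2.
Proof. by rewrite /P1 /P2 /P3; field. Qed.

Lemma F_beta0 (F1 F2 : R -> R) (beta x : R) : F1 x = 0 -> F2 x = 0 ->
  F_beta p1 p2 p3 p4 F1 F2 beta x = 0.
Proof. by move=> F10 F20; rewrite /F_beta /H /J F10 F20; ring. Qed.

Lemma F_beta1 (F1 F2 : R -> R) (beta x : R) : F1 x = 1 -> F2 x = 1 ->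
  F_beta p1 p2 p3 p4 F1 F2 beta x = 1.
Proof.
by move=> F11 F21; rewrite /F_beta /H /J F11 F21 /P1 /P2 /P3; field.
Qed.

(** A general filter covers continuity and both limits at infinity. The constant functions express
    the mixture as a polynomial evaluated at [a] and [b]; the point 0 is arbitrary. *)
Lemma cvg_F_beta (F : set_system R) {FF : Filter F} (F1 F2 : R -> R)
    (a b beta : R) :
  F1 x @[x --> F] --> a -> F2 x @[x --> F] --> b ->
  F_beta p1 p2 p3 p4 F1 F2 beta x @[x --> F] -->
  F_beta p1 p2 p3 p4 (cst a) (cst b) beta 0.
Proof.
move=> F1a F2b.
have cvgH : H p1 p2 p3 p4 F1 F2 x @[x --> F] -->
    H p1 p2 p3 p4 (cst a) (cst b) 0.
  rewrite /H /= !expr2; under eq_fun do rewrite !expr2.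
  by apply: cvgD; [apply: cvgD|]; repeat (apply: cvgM => //; try exact: cvg_cst).
have cvgJ : J p1 p2 p3 p4 F1 F2 x @[x --> F] -->
    J p1 p2 p3 p4 (cst a) (cst b) 0.
  apply: cvgD; [apply: cvgD|]; apply: cvgM; try exact: cvg_cst => //.
  - by [].
  - exact: cvgD.
  - by [].
apply: cvgD; apply: cvgM; try exact: cvg_cst => //.
- by [].
- exact: cvgB.
Qed.

Variables F1 F2 : R -> R.
Hypotheses (p1_01 : in01 p1) (p2_01 : in01 p2) (p3_01 : in01 p3)
  (p4_01 : in01 p4).
Hypotheses (F1_01 : forall x, in01 (F1 x)) (F2_01 : forall x, in01 (F2 x)).

Let P1_ge0' : 0 <= P1 p1 p2 p3 p4.
Proof.
move: p1_01 p2_01 p3_01 p4_01.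
by move=> /andP[? ?] /andP[? ?] /andP[? ?] /andP[? ?]; exact: P1_ge0.
Qed.

Let P2_ge0' : 0 <= P2 p1 p2 p3 p4. Proof. exact: P2_ge0. Qed.

Let P3_ge0' : 0 <= P3 p1 p2 p3 p4.
Proof.
move: p1_01 p2_01 p3_01 p4_01.
by move=> /andP[? ?] /andP[? ?] /andP[? ?] /andP[? ?]; exact: P3_ge0.
Qed.

Lemma H_le_J (x : R) : H p1 p2 p3 p4 F1 F2 x <= J p1 p2 p3 p4 F1 F2 x.
Proof.
rewrite -subr_ge0 /H /J.
have := F1_01 x; have := F2_01 x.
move: (F1 x) (F2 x) => a b /andP[b0 b1] /andP[a0 a1].
rewrite [leRHS](_ : _ = P1 p1 p2 p3 p4 * (a * (1 - a)) +
  P2 p1 p2 p3 p4 * (a * (1 - b) + b * (1 - a)) +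
  P3 p1 p2 p3 p4 * (b * (1 - b))); last by ring.
have na0 : 0 <= 1 - a by rewrite subr_ge0.
have nb0 : 0 <= 1 - b by rewrite subr_ge0.
by rewrite !addr_ge0// mulr_ge0// ?addr_ge0// mulr_ge0.
Qed.

Lemma F_beta_antimono (beta1 beta2 x : R) : beta1 <= beta2 ->
  F_beta p1 p2 p3 p4 F1 F2 beta2 x <= F_beta p1 p2 p3 p4 F1 F2 beta1 x.
Proof.
by move=> b12; rewrite lerD2l ler_wpM2r ?subr_ge0 ?H_le_J// lerD2l lerN2.
Qed.

Lemma F_beta_mono (beta : R) : in01 beta ->
  {homo F1 : x y / x < y} -> {homo F2 : x y / x < y} ->
  {homo F_beta p1 p2 p3 p4 F1 F2 beta : x y / x < y}.
Proof.
move=> beta01 F1_mono F2_mono x y xy.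
have [a0 a1] := andP (F1_01 x); have [b0 b1] := andP (F2_01 x).
have [a'0 a'1] := andP (F1_01 y); have [b'0 b'1] := andP (F2_01 y).
have aa' := F1_mono _ _ xy; have bb' := F2_mono _ _ xy.
rewrite -subr_gt0 /F_beta /H /J.
move: (F1 x) (F1 y) (F2 x) (F2 y) a0 a1 b0 b1 a'0 a'1 b'0 b'1 aa' bb'.
move=> a a' b b' a0 a1 b0 b1 a'0 a'1 b'0 b'1 aa' bb'.
(* F_beta y - F_beta x is linear in P1, P2, P3; [weight c c'] is its factor of
   an increment c' - c, and a convex combination of (c + c') / 2 and
   1 - (c + c') / 2. *)
pose weight c c' := (beta * (c + c') + (1 - beta) * (2 - (c + c'))) / 2.
have weight_gt0 c c' : 0 <= c -> c' <= 1 -> c < c' -> 0 < weight c c'.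
  move=> c0 c'1 cc'; rewrite /weight divr_gt0//.
  (* Both [c + c'] and [2 - (c + c')] are positive, and [beta], [1 - beta] are not both zero. *)
  by have [/andP[] ?] := beta01; nra.
have wa := weight_gt0 _ _ a0 a'1 aa'; have wb := weight_gt0 _ _ b0 b'1 bb'.
move: P1_ge0' P2_ge0' P3_ge0' P_sum.
move: (P1 _ _ _ _) (P2 _ _ _ _) (P3 _ _ _ _) => q1 q2 q3 q1_0 q2_0 q3_0 q_sum.
(* The cross term [a' * b' - a * b] is split symmetrically, so in the [q2] part each increment
   carries the weight of the other function. *)
rewrite [ltRHS](_ : _ = q1 * ((a' - a) * weight a a') +
  q2 * ((a' - a) * weight b b' + (b' - b) * weight a a') +
  q3 * ((b' - b) * weight b b')); last by rewrite /weight; field.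
have da : 0 < a' - a by rewrite subr_gt0.
have db : 0 < b' - b by rewrite subr_gt0.
have t1 : 0 < (a' - a) * weight a a' by rewrite mulr_gt0.
have t2 : 0 < (a' - a) * weight b b' + (b' - b) * weight a a'.
  by apply: addr_gt0; exact: mulr_gt0.
have t3 : 0 < (b' - b) * weight b b' by rewrite mulr_gt0.
have u1 := mulr_ge0 q1_0 (ltW t1); have u2 := mulr_ge0 q2_0 (ltW t2).
have u3 := mulr_ge0 q3_0 (ltW t3).
(* One positive coefficient suffices; if [q1] and [q2] vanish, [q_sum] forces [q3 = 2]. *)
have [q1_gt0|q1_le0] := ltP 0 q1.
  by rewrite ltr_wpDr// ltr_wpDr// mulr_gt0.
have [q2_gt0|q2_le0] := ltP 0 q2.
  by rewrite ltr_wpDr// ltr_wpDl// mulr_gt0.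
by rewrite ltr_wpDl ?addr_ge0// mulr_gt0//; lra.
Qed.

End Mixture.

(** * Quantiles and their comparison *)

Lemma continuous_incr_preimage (R : realType) (f : R -> R) (a b y : R) :
  continuous f -> {homo f : x z / x < z} ->
  f x @[x --> -oo] --> a -> f x @[x --> +oo] --> b -> a < y < b ->
  exists! x : R, f x = y.
Proof.
move=> f_cont f_mono f_a f_b /andP[ay yb].
(* The two limits supply points bracketing the level [y], as the intermediate value theorem
   requires. *)
have [l fl] : exists l, f l < y.
  have : \forall x \near -oo, f x < y by apply: (cvgr_lt _ f_a).
  by move=> /filter_ex.
have [u fu] : exists u, y < f u.
  have : \forall x \near +oo, y < f x by apply: (cvgr_gt _ f_b).
  by move=> /filter_ex.
have f_mon := le_mono f_mono.
have lu : l <= u by rewrite -f_mon ltW// (lt_trans fl).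
have [||x _ fx] := @IVT _ f l u y lu; first exact: continuous_subspaceT.
  by rewrite ge_min (ltW fl)/= le_max (ltW fu) orbT.
by exists x; split => // z fz; apply: (inc_inj f_mon); rewrite fx fz.
Qed.

(** Unique existence rules out the default value of [xget]. *)
Lemma the_preimageK (R : realType) (f : R -> R) (y : R) :
  (exists! x, f x = y) -> f (the_preimage f y) = y.
Proof.
move=> [x fx]; rewrite /the_preimage.
by case: xgetP => [z _ []|/(_ x)].
Qed.

(** The first conjunct certifies that, for [beta] in the unit interval, [optimal_quantity] is a
    genuine quantile and not the default 0. *)
Theorem proposition4p2 (R : realType) (mu1 mu2 sigma1 sigma2 : R)
    (V C M p1 p2 p3 p4 : R)
    (hsigma1 : 0 < sigma1) (hsigma2 : 0 < sigma2)
    (hVC : V < C) (hCM : C < M)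
    (hp1 : 0 <= p1) (hp12 : p1 <= p2) (hp23 : p2 <= p3) (hp34 : p3 <= p4)
    (hp4 : p4 <= 1) :
  let F1 := normal_cdf mu1 sigma1 in
  let F2 := normal_cdf mu2 sigma2 in
  (forall beta : R, 0 <= beta <= 1 ->
     exists! x : R, F_beta p1 p2 p3 p4 F1 F2 beta x = (M - C) / (M - V)) /\
  {in `[0, 1] &,
    {homo optimal_quantity V C M p1 p2 p3 p4 F1 F2 : beta1 beta2
      / beta1 <= beta2}}.
Proof.
move=> F1 F2.
have s1 : sigma1 != 0 by rewrite gt_eqF.
have s2 : sigma2 != 0 by rewrite gt_eqF.
have F1_01 x : 0 <= F1 x <= 1 by rewrite normal_cdf_ge0 normal_cdf_le1.
have F2_01 x : 0 <= F2 x <= 1 by rewrite normal_cdf_ge0 normal_cdf_le1.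
have p1_01 : 0 <= p1 <= 1 by lra.
have p2_01 : 0 <= p2 <= 1 by lra.
have p3_01 : 0 <= p3 <= 1 by lra.
have p4_01 : 0 <= p4 <= 1 by lra.
have mono (beta : R) : 0 <= beta <= 1 ->
    {homo F_beta p1 p2 p3 p4 F1 F2 beta : x y / x < y}.
  by move=> beta01; apply: F_beta_mono => //; exact: normal_cdf_mono.
have preimage (beta : R) : 0 <= beta <= 1 ->
    exists! x : R, F_beta p1 p2 p3 p4 F1 F2 beta x = (M - C) / (M - V).
  move=> beta01; apply: (@continuous_incr_preimage _ _ 0 1).
  - by move=> x; apply: cvg_F_beta; exact: continuous_normal_cdf.
  - exact: mono.
  - rewrite -(@F_beta0 _ p1 p2 p3 p4 (cst 0) (cst 0) beta 0)//.
    by apply: cvg_F_beta; exact: cvg_normal_cdfNy.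
  - rewrite -(@F_beta1 _ p1 p2 p3 p4 (cst 1) (cst 1) beta 0)//.
    by apply: cvg_F_beta; exact: cvg_normal_cdfy.
  - by rewrite divr_gt0 ?ltr_pdivrMr ?mul1r/=; lra.
split=> // beta1 beta2; rewrite !in_itv/= => b1 b2 b12.
(* The increasing mixture for [beta2] is applied to both quantiles. The right side becomes the
   common level, which is also the mixture for [beta1] at its own quantile, so both sides are
   compared at one point. *)
rewrite -(le_mono (mono _ b2)).
rewrite [leRHS]the_preimageK; last exact: preimage.
rewrite -[leRHS](the_preimageK _ _ _ (preimage _ b1)).
exact: F_beta_antimono.
Qed.
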